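(* In the two-cut DDP instance of FDDP (see context), for every $k\ge1$ and $t\in\{1,\ldots,T-1\}$, the affine function $$\overline\Gamma_t^k(\cdot)=\begin{cases}\Gamma_t^1(\cdot),&k=1,\\ \beta_t^k\,\overline\Gamma_t^{k-1}(\cdot)+(1-\beta_t^k)\,\ell_t^k(\cdot),&k\ge2,\end{cases}$$ is a shadow of $\Gamma_t^k$ for the problem $\min_{u_t\in X_t}F_t(u_t,x_{t-1}^k)+\Gamma_t^k(u_t)$; that is, $\overline\Gamma_t^k\in\mathcal B_{X_t}(\mathcal Q_t)$, $\overline\Gamma_t^k(x_t^k)=\Gamma_t^k(x_t^k)$, and $x_t^k=\operatorname{argmin}_{u_t\in X_t}F_t(u_t,x_{t-1}^k)+\overline\Gamma_t^k(u_t)$.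
   Context: **Problem.** $T$ is the number of stages, $x_0\in\mathbb R^{n_0}$ is fixed, and (P) is $\min_{(x_1,\ldots,x_T)\in X_1\times\cdots\times X_T}\sum_{t=1}^T F_t(x_t,x_{t-1})$. Assumptions, for every $t=1,\ldots,T$: (A0) $X_0=\{x_0\}$ and $X_t\subset\mathbb R^{n_t}$ is nonempty, convex, compact; (A1) $F_t:\mathbb R^{n_t}\times\mathbb R^{n_{t-1}}\to\mathbb R$ is convex (jointly) and finite everywhere; (A2) there is $\mu_t>0$ such that $F_t(\cdot,x_{t-1})$ is $\mu_t$-strongly convex for every $x_{t-1}\in X_{t-1}$; (A3) there is $M_{t-1}\ge0$ such that for every $(x_t,x_{t-1})\in X_t\times X_{t-1}$ every subgradient at $x_{t-1}$ of the convex function $F_t(x_t,\cdot)$ on $\mathbb R^{n_{t-1}}$ has Euclidean norm at most $M_{t-1}$. **Functions.** $G_{t-1}(u_t,\ldots,u_T;u_{t-1})=\sum_{s=t}^T F_s(u_s,u_{s-1})$. $\mathcal Q_T\equiv0$ on $X_T$, and for $t=1,\ldots,T$, $\mathcal Q_{t-1}(x_{t-1})=\min_{(u_t,\ldots,u_T)\in X_t\times\cdots\times X_T}G_{t-1}(u_t,\ldots,u_T;x_{t-1})$ for $x_{t-1}\in X_{t-1}$. For a convex lower semicontinuous real-valued $\Gamma_t$ on $X_t$, $\mathcal V_{t-1}(x_{t-1};\Gamma_t)=\min_{u_t\in X_t}F_t(u_t,x_{t-1})+\Gamma_t(u_t)$, a convex function of $x_{t-1}\in\mathbb R^{n_{t-1}}$.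 $\mathcal B_{X_t}(\mathcal Q_t)$ is the set of convex lower semicontinuous functions on $X_t$ that minorize $\mathcal Q_t$ on $X_t$. **Two-cut DDP.** Start from $(x_1^0,\ldots,x_T^0)\in X_1\times\cdots\times X_T$. Step 1. $k=1$, $\Gamma_T^1\equiv0$. For $t=T-1,\ldots,1$ choose a subgradient $s_t^0$ of $\mathcal V_t(\cdot;\Gamma_{t+1}^1)$ at $x_t^0$ and set $\Gamma_t^1(\cdot)=\mathcal V_t(x_t^0;\Gamma_{t+1}^1)+\langle s_t^0,\cdot-x_t^0\rangle$. Step 2. With $x_0^k=x_0$, for $t=1,\ldots,T$ let $x_t^k=\operatorname{argmin}_{u_t\in X_t}F_t(u_t,x_{t-1}^k)+\Gamma_t^k(u_t)$ and let $m_{t-1}^k$ be the optimal value. Step 3. For $t=T-1,\ldots,1$ define $\overline\Gamma_t^k$ by the formula in the claim. Then set $\Gamma_T^{k+1}\equiv0$ and, for $t=T-1,\ldots,1$, choose a subgradient $s_t^k$ of $\mathcal V_t(\cdot;\Gamma_{t+1}^{k+1})$ at $x_t^k$, and set $\ell_t^{k+1}(\cdot)=\mathcal V_t(x_t^k;\Gamma_{t+1}^{k+1})+\langle s_t^k,\cdot-x_t^k\rangle$ and $\Gamma_t^{k+1}=\max\{\ell_t^{k+1},\overline\Gamma_t^k\}$. Replace $k$ by $k+1$ and return to Step 2. (The stopping test plays no role here.) For $k\ge2$ and $1\le t\le T-1$, since $\Gamma_t^k=\max\{\ell_t^k,\overline\Gamma_t^{k-1}\}$, the stage problem is equivalent to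 $$m_{t-1}^k=\min_{u_t\in X_t,\ \gamma_t\in\mathbb R}\left\{F_t(u_t,x_{t-1}^k)+\gamma_t:\ \overline\Gamma_t^{k-1}(u_t)-\gamma_t\le0,\ \ \ell_t^k(u_t)-\gamma_t\le0\right\},$$ and $\beta_t^k\in[0,1]$ denotes an optimal Lagrange multiplier of the first constraint (the multiplier of the second being $1-\beta_t^k$). *)

(* Defs.v *)
From HB Require Import structures.
From mathcomp Require Import all_boot all_order all_algebra.
From mathcomp Require Import all_classical all_reals all_analysis.

Set Implicit Arguments.
Unset Strict Implicit.
Unset Printing Implicit Defensive.

Import Order.TTheory GRing.Theory Num.Theory.
Import numFieldNormedType.Exports.

Local Open Scope classical_set_scope.
Local Open Scope ring_scope.

(** ** Euclidean space and convexity *)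

(* The library's norm on matrices is the sup norm, hence [enorm]. *)
Definition dot (R : realType) (d : nat) (u v : 'rV[R]_d) : R :=
  \sum_(i < d) u 0 i * v 0 i.

Definition enorm (R : realType) (d : nat) (u : 'rV[R]_d) : R :=
  Num.sqrt (dot u u).

Definition strongly_convex (R : realType) (d : nat) (mu : R)
    (f : 'rV[R]_d -> R) : Prop :=
  forall (x y : 'rV[R]_d) (a : R), 0 <= a <= 1 ->
    f (a *: x + (1 - a) *: y) <=
      a * f x + (1 - a) * f y - mu / 2 * a * (1 - a) * enorm (x - y) ^+ 2.

Definition subgradient (R : realType) (d : nat) (f : 'rV[R]_d -> R)
    (x s : 'rV[R]_d) : Prop :=
  forall y, f x + dot s (y - x) <= f y.

Definition is_affine (R : realType) (d : nat) (f : 'rV[R]_d -> R) : Prop :=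
  exists (b : R) (s : 'rV[R]_d), forall u, f u = b + dot s u.

(* In [subspace A] the neighbourhoods of a point of [A] are the relative ones
   and every other point is isolated. *)
Definition lsc_on (R : realType) (d : nat) (A : set 'rV[R]_d)
    (f : 'rV[R]_d -> R) : Prop :=
  lower_semicontinuous ((fun u => (f u)%:E) : subspace A -> \bar R).

Definition argmin (R : realType) (U : Type) (A : set U) (f : U -> R) : set U :=
  [set x | A x /\ forall u, A u -> f x <= f u].

(** ** Lagrangian duality for [min { f z : z in D, g1 z <= 0, g2 z <= 0 }] *)

Definition dual_function (R : realType) (Z : Type) (D : set Z)
    (f g1 g2 : Z -> R) (l1 l2 : R) : \bar R :=
  ereal_inf [set (f z + l1 * g1 z + l2 * g2 z)%:E | z in D].

Definition optimal_multipliers (R : realType) (Z : Type) (D : set Z)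
    (f g1 g2 : Z -> R) (l1 l2 : R) : Prop :=
  [/\ 0 <= l1, 0 <= l2 &
      forall l1' l2' : R, 0 <= l1' -> 0 <= l2' ->
        (dual_function D f g1 g2 l1' l2' <= dual_function D f g1 g2 l1 l2)%E].

(** ** The multistage problem *)

(* [F t u y] is F_t(u, y) with u in R^(n_t) and y in R^(n_(t-1)); only
   1 <= t <= T is meaningful. *)
Record standing_assumptions (R : realType) (T : nat) (n : nat -> nat)
    (x0 : 'rV[R]_(n 0%N)) (X : forall t : nat, set 'rV[R]_(n t))
    (F : forall t : nat, 'rV[R]_(n t) -> 'rV[R]_(n t.-1) -> R) : Prop := {
  A0_initial : X 0%N = [set x0];
  A0_nonempty : forall t, (1 <= t <= T)%N -> X t !=set0;
  A0_convex : forall t, (1 <= t <= T)%N -> convex_set (X t);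
  A0_compact : forall t, (1 <= t <= T)%N -> compact (X t);
  A1_convex : forall t, (1 <= t <= T)%N ->
    convex_function setT
      (fun p : ('rV[R]_(n t) * 'rV[R]_(n t.-1))%type => F t p.1 p.2);
  A2_strongly_convex : forall t, (1 <= t <= T)%N ->
    exists mu : R, 0 < mu /\
      forall y, X t.-1 y -> strongly_convex mu (fun u => F t u y);
  A3_bounded_subgradients : forall t, (1 <= t <= T)%N ->
    exists M : R, 0 <= M /\
      forall u y, X t u -> X t.-1 y ->
        forall s, subgradient (F t u) y s -> enorm s <= M
}.

(* Minima are written as infima; under the standing assumptions those below
   are attained.  A decision (u_(t+1), ..., u_T) is encoded by a whole
   trajectory [u] with [u t = x], whose other components are irrelevant.  For
   t = T the sum is empty, so [cost_to_go] is then identically 0. *)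
Definition G_cost (R : realType) (T : nat) (n : nat -> nat)
    (F : forall t : nat, 'rV[R]_(n t) -> 'rV[R]_(n t.-1) -> R)
    (t : nat) (u : forall s : nat, 'rV[R]_(n s)) : R :=
  \sum_(t.+1 <= s < T.+1) F s (u s) (u s.-1).

Definition cost_to_go (R : realType) (T : nat) (n : nat -> nat)
    (X : forall t : nat, set 'rV[R]_(n t))
    (F : forall t : nat, 'rV[R]_(n t) -> 'rV[R]_(n t.-1) -> R)
    (t : nat) (x : 'rV[R]_(n t)) : R :=
  inf [set G_cost T F t u | u in
        [set u : forall s : nat, 'rV[R]_(n s) |
          u t = x /\ forall s, (t < s <= T)%N -> X s (u s)]].

Definition stage_value (R : realType) (n : nat -> nat)
    (X : forall t : nat, set 'rV[R]_(n t))
    (F : forall t : nat, 'rV[R]_(n t) -> 'rV[R]_(n t.-1) -> R)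
    (t : nat) (Gam : 'rV[R]_(n t.+1) -> R) (x : 'rV[R]_(n t)) : R :=
  inf [set F t.+1 u x + Gam u | u in X t.+1].

(* B_X(Q). *)
Definition bundle (R : realType) (d : nat) (A : set 'rV[R]_d)
    (Q : 'rV[R]_d -> R) : set ('rV[R]_d -> R) :=
  [set f | [/\ convex_function A f, lsc_on A f &
               forall u, A u -> f u <= Q u]].

(* [f] is a shadow of [Gam] for the problem min over A of [phi + Gam], whose
   solution is [x]. *)
Definition is_shadow (R : realType) (d : nat) (A : set 'rV[R]_d)
    (Q phi Gam : 'rV[R]_d -> R) (x : 'rV[R]_d) (f : 'rV[R]_d -> R) : Prop :=
  [/\ bundle A Q f, f x = Gam x & argmin A (fun u => phi u + f u) = [set x]].

(** ** Two-cut DDP *)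

(* The superscript k comes first and the stage t second.  [Gam], [Gbar] and
   [ell] stand for Gamma, overlined Gamma and the cut l. *)
Record two_cut_ddp (R : realType) (T : nat) (n : nat -> nat)
    (x0 : 'rV[R]_(n 0%N)) (X : forall t : nat, set 'rV[R]_(n t))
    (F : forall t : nat, 'rV[R]_(n t) -> 'rV[R]_(n t.-1) -> R)
    (x s : nat -> forall t : nat, 'rV[R]_(n t)) (beta : nat -> nat -> R)
    (Gam Gbar ell : nat -> forall t : nat, 'rV[R]_(n t) -> R) : Prop := {
  start : forall t, (1 <= t <= T)%N -> X t (x 0%N t);

  Gam_last : forall k, (1 <= k)%N -> forall u, Gam k T u = 0;

  step1_subgradient : forall t, (1 <= t < T)%N ->
    subgradient (stage_value X F (Gam 1%N t.+1)) (x 0%N t) (s 0%N t);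
  step1_Gam : forall t, (1 <= t < T)%N -> forall u,
    Gam 1%N t u = stage_value X F (Gam 1%N t.+1) (x 0%N t)
                  + dot (s 0%N t) (u - x 0%N t);

  step2_initial : forall k, (1 <= k)%N -> x k 0%N = x0;
  step2_argmin : forall k t, (1 <= k)%N -> (1 <= t <= T)%N ->
    argmin (X t) (fun u => F t u (x k t.-1) + Gam k t u) = [set x k t];

  (* The variable of the stage problem is z = (u_t, gamma_t). *)
  multiplier : forall k t, (2 <= k)%N -> (1 <= t < T)%N ->
    optimal_multipliers
      [set z : 'rV[R]_(n t) * R | X t z.1]
      (fun z => F t z.1 (x k t.-1) + z.2)
      (fun z => Gbar k.-1 t z.1 - z.2)
      (fun z => ell k t z.1 - z.2)
      (beta k t) (1 - beta k t);

  step3_Gbar1 : forall t, (1 <= t < T)%N -> forall u,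
    Gbar 1%N t u = Gam 1%N t u;
  step3_Gbar : forall k t, (2 <= k)%N -> (1 <= t < T)%N -> forall u,
    Gbar k t u = beta k t * Gbar k.-1 t u + (1 - beta k t) * ell k t u;
  step3_subgradient : forall k t, (1 <= k)%N -> (1 <= t < T)%N ->
    subgradient (stage_value X F (Gam k.+1 t.+1)) (x k t) (s k t);
  step3_ell : forall k t, (1 <= k)%N -> (1 <= t < T)%N -> forall u,
    ell k.+1 t u = stage_value X F (Gam k.+1 t.+1) (x k t)
                   + dot (s k t) (u - x k t);
  step3_Gam : forall k t, (1 <= k)%N -> (1 <= t < T)%N -> forall u,
    Gam k.+1 t u = Num.max (ell k.+1 t u) (Gbar k t u)
}.

(* Main.v *)
(** [Gbar k t] and [Gam k t] minorize the cost-to-go: going backwards in [t], a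
    cut at stage [t] lies below V_t(.; Gamma_(t+1)), hence below Q_t, and both
    maxima and convex combinations of minorants are minorants.  For the other two
    properties, strong duality (a one-dimensional alternative for two convex
    functions whose maximum is nonnegative) shows that any dual optimal
    multiplier makes [F + Gbar k t] bounded below on [X t] by the optimal value of
    [F + Gam k t]; since [Gbar k t <= Gam k t], the two objectives coincide at the
    iterate, which is then the minimizer of [F + Gbar k t], unique by strong
    convexity. *)

Require Import Defs.
From HB Require Import structures.
From mathcomp Require Import all_boot all_order all_algebra.
From mathcomp Require Import all_classical all_reals all_analysis.
From mathcomp Require Import ring lra zify.

Set Implicit Arguments.
Unset Strict Implicit.
Unset Printing Implicit Defensive.

Import Order.TTheory GRing.Theory Num.Theory.
Import numFieldNormedType.Exports.

Local Open Scope classical_set_scope.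
Local Open Scope ring_scope.

(** * Convexity with explicit real weights *)

Lemma convex_setP (R : realType) (V : lmodType R) (A : set V) :
  convex_set A <-> forall (a : R) (x y : V), 0 <= a <= 1 -> A x -> A y ->
    A (a *: x + (1 - a) *: y).
Proof.
split=> [cA a x y /andP[a0 a1] Ax Ay | cA x y p]; last first.
  rewrite !inE => Ax Ay.
  have p01 : 0 <= p%:num <= 1 by rewrite ge0 le1.
  exact: cA p01 Ax Ay.
by have := cA x y (Itv01 a0 a1) (mem_set Ax) (mem_set Ay); rewrite inE.
Qed.

Lemma convex_functionP (R : realType) (V : lmodType R) (A : set V) (f : V -> R) :
  convex_function A f <-> forall (a : R) (x y : V), 0 <= a <= 1 -> A x -> A y ->
    f (a *: x + (1 - a) *: y) <= a * f x + (1 - a) * f y.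
Proof.
split=> [cf a x y /andP[a0 a1] Ax Ay | cf p x y].
  exact: cf (Itv01 a0 a1) x y (mem_set Ax) (mem_set Ay).
rewrite !inE => Ax Ay.
have p01 : 0 <= p%:num <= 1 by rewrite ge0 le1.
exact: cf p01 Ax Ay.
Qed.

Lemma convex_functionD (R : realType) (V : lmodType R) (A : set V)
    (f g : V -> R) :
  convex_function A f -> convex_function A g ->
  convex_function A (fun u => f u + g u).
Proof.
move=> /convex_functionP cf /convex_functionP cg.
apply/convex_functionP => a x y a01 Ax Ay.
by have := cf a x y a01 Ax Ay; have := cg a x y a01 Ax Ay; lra.
Qed.

Lemma convex_function_max (R : realType) (V : lmodType R) (A : set V)
    (f g : V -> R) :
  convex_function A f -> convex_function A g ->
  convex_function A (fun u => Num.max (f u) (g u)).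
Proof.
move=> /convex_functionP cf /convex_functionP cg.
apply/convex_functionP => a x y a01 Ax Ay.
have /andP[a0 a1] := a01.
have a1' : 0 <= 1 - a by rewrite subr_ge0.
rewrite ge_max; apply/andP; split.
  apply: le_trans (cf a x y a01 Ax Ay) _.
  by rewrite lerD// ler_wpM2l// le_max lexx.
apply: le_trans (cg a x y a01 Ax Ay) _.
by rewrite lerD// ler_wpM2l// le_max lexx orbT.
Qed.

Lemma convex_function_cst (R : realType) (V : lmodType R) (A : set V) (c : R) :
  convex_function A (fun _ : V => c).
Proof. by apply/convex_functionP => a x y _ _ _; lra. Qed.

(** * Affine functions, and uniqueness of minimizers *)

Section Affine.
Context {R : realType} {d : nat}.
Implicit Types (f g : 'rV[R]_d -> R) (s u v : 'rV[R]_d).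

Lemma dotDr s u v : dot s (u + v) = dot s u + dot s v.
Proof. by rewrite -big_split; apply: eq_bigr => i _; rewrite mxE mulrDr. Qed.

Lemma dotZr a s u : dot s (a *: u) = a * dot s u.
Proof. by rewrite /dot mulr_sumr; apply: eq_bigr => i _; rewrite mxE; ring. Qed.

Lemma dotC u v : dot u v = dot v u.
Proof. by apply: eq_bigr => i _; rewrite mulrC. Qed.

Lemma enorm_sqr_gt0 u : u != 0 -> 0 < enorm u ^+ 2.
Proof.
move=> u0; have duu i : 0 <= u 0 i * u 0 i by rewrite -expr2 sqr_ge0.
rewrite /enorm sqr_sqrtr ?sumr_ge0// lt_neqAle sumr_ge0// andbT eq_sym.
apply: contra u0; rewrite psumr_eq0// => /allP u0.
apply/eqP/rowP => i; have := u0 i (mem_index_enum i).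
by rewrite mxE mulf_eq0 orbb => /eqP.
Qed.

Lemma affine_cut b s v : is_affine (fun u => b + dot s (u - v)).
Proof.
exists (b + dot s (- v)), s => u.
by rewrite dotDr; ring.
Qed.

Lemma affine_comb a b f g : is_affine f -> is_affine g ->
  is_affine (fun u => a * f u + b * g u).
Proof.
move=> [bf [sf fE]] [bg [sg gE]].
exists (a * bf + b * bg), (a *: sf + b *: sg) => u.
by rewrite fE gE (dotC (_ + _)) dotDr !dotZr !(dotC u); ring.
Qed.

Lemma affine_ext f g : f =1 g -> is_affine g -> is_affine f.
Proof. by move=> /funext ->. Qed.

Lemma affine_convex A f : is_affine f -> convex_function A f.
Proof.
move=> [b [s fE]]; apply/convex_functionP => a x y _ _ _.
by rewrite !fE dotDr !dotZr; lra.
Qed.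

Lemma affine_continuous f : is_affine f -> continuous f.
Proof.
move=> [b [s /funext ->]] u.
have ds : continuous (dot s).
  rewrite /dot; apply: continuous_big => [|i _ v]; first exact: add_continuous.
  by apply: continuousM; [exact: cst_continuous | exact: coord_continuous].
exact: (cvgD (cvg_cst b) (ds u)).
Qed.

Lemma continuous_lsc_on A f : continuous f -> lsc_on A f.
Proof.
move=> cf u a; rewrite lte_fin => afu.
exists [set v | a < f v]; last by move=> v; rewrite lte_fin.
have : {for u, continuous (f : subspace A -> R)}.
  exact: (continuous_subspaceT cf).
by move=> /(_ [set r | a < r]); apply; apply: open_nbhs_nbhs; split => //; exact: open_gt.
Qed.

(** At the midpoint of two distinct minimizers, the quadratic term of [phi] would push the objective
    strictly below the minimum. *)
Lemma strongly_convex_argmin_unique (mu : R) (A : set 'rV[R]_d)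
    (phi g : 'rV[R]_d -> R) x :
  0 < mu -> strongly_convex mu phi -> convex_set A -> convex_function A g ->
  argmin A (fun u => phi u + g u) x ->
  argmin A (fun u => phi u + g u) = [set x].
Proof.
move=> mu0 sphi /convex_setP cA /convex_functionP cg [Ax xmin].
apply/seteqP; split=> [y [Ay ymin]|_ ->//] /=.
apply/eqP; rewrite -subr_eq0; apply/negPn/negP => /enorm_sqr_gt0 yx0.
have h01 : 0 <= (2^-1 : R) <= 1 by lra.
have := xmin _ (cA _ _ _ h01 Ay Ax).
have := sphi y x _ h01; have := cg _ _ _ h01 Ay Ax; have := ymin _ Ax.
have : 0 < mu * enorm (y - x) ^+ 2 by rewrite mulr_gt0.
by lra.
Qed.

End Affine.

(** * Scalar alternative and Lagrange multipliers *)

(** A point with [g < 0] bounds [b] below by [- g / (f - g)], one with [f < 0] bounds it above by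
    [g / (g - f)]. No lower bound exceeds an upper one, so the supremum of the lower bounds
    works. *)
Lemma multiplier_exists (R : realType) (V : lmodType R) (A : set V)
    (f g : V -> R) :
  convex_set A -> convex_function A f -> convex_function A g ->
  (forall u, A u -> 0 <= Num.max (f u) (g u)) ->
  exists b : R, 0 <= b <= 1 /\ forall u, A u -> 0 <= b * f u + (1 - b) * g u.
Proof.
move=> /convex_setP cA /convex_functionP cf /convex_functionP cg fg0.
have fpos u : A u -> g u < 0 -> 0 <= f u.
  by move=> /fg0; rewrite le_max => /orP[//|]; lra.
have gpos u : A u -> f u < 0 -> 0 <= g u.
  by move=> /fg0; rewrite le_max => /orP[|//]; lra.
(* This compares the upper bound at [u] with the lower bound at [v], denominators cleared. Were it
   false, some point of the segment would make both functions negative. *)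
have cross u v : A u -> A v -> f u < 0 -> g v < 0 -> f u * g v <= f v * g u.
  move=> Au Av fu gv; rewrite leNgt; apply/negP => lt_fg.
  have fv := fpos _ Av gv; have gu := gpos _ Au fu.
  (* the weights [f v - g v] of [u] and [g u - f u] of [v] make both convexity
     bounds negative *)
  pose D := f v - g v + (g u - f u); have D0 : 0 < D by rewrite /D; lra.
  pose a := (f v - g v) / D.
  have a01 : 0 <= a <= 1.
    by rewrite /a divr_ge0 ?ler_pdivrMr ?mul1r//= /D; lra.
  have Da : D * a = f v - g v by rewrite /a mulrC divfK// gt_eqF.
  have Dmix r r' : D * (a * r + (1 - a) * r')
                 = (f v - g v) * r + (D - (f v - g v)) * r' by rewrite -Da; ring.
  have := fg0 _ (cA a u v a01 Au Av); apply/negP; rewrite -ltNge gt_max.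
  apply/andP; split.
    apply: le_lt_trans (cf a u v a01 Au Av) _.
    by rewrite -(pmulr_rlt0 _ D0) Dmix /D; lra.
  apply: le_lt_trans (cg a u v a01 Au Av) _.
  by rewrite -(pmulr_rlt0 _ D0) Dmix /D; lra.
(* Adding 0 to the lower bounds keeps [S] nonempty and its supremum nonnegative. *)
pose S := [set r : R | r = 0 \/
  exists v, [/\ A v, g v < 0 & r = - g v / (f v - g v)]].
have S0 : S 0 by left.
have Sup c : 0 <= c ->
    (forall v, A v -> g v < 0 -> - g v / (f v - g v) <= c) -> sup S <= c.
  move=> c0 Sc; apply: ge_sup; first by exists 0.
  by move=> r [->//|[v [Av gv ->]]]; exact: Sc.
have Sle1 v : A v -> g v < 0 -> - g v / (f v - g v) <= 1.
  move=> Av gv; have := fpos _ Av gv => fv.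
  by rewrite ler_pdivrMr ?mul1r; lra.
have hS : has_sup S.
  split; first by exists 0.
  by exists 1 => r [->|[v [Av gv ->]]]; [exact: ler01 | exact: Sle1].
exists (sup S); split.
  by rewrite Sup//= ?andbT; exact: sup_upper_bound.
have b0 : 0 <= sup S by exact: sup_upper_bound.
have b1 : sup S <= 1 by apply: Sup.
move=> u Au; have [gu|gu] := ltP (g u) 0.
  have fu := fpos _ Au gu.
  have : - g u / (f u - g u) <= sup S.
    by apply: sup_upper_bound => //; right; exists u.
  by rewrite ler_pdivrMr; lra.
have [fu|fu] := ltP (f u) 0; last first.
  by rewrite addr_ge0// mulr_ge0// subr_ge0.
suff : sup S <= g u / (g u - f u) by rewrite ler_pdivlMr; lra.
apply: Sup; first by rewrite divr_ge0//; lra.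
move=> v Av gv; have fv := fpos _ Av gv; have := cross _ _ Au Av fu gv.
have ? : 0 < f v - g v by lra.
have ? : 0 < g u - f u by lra.
by rewrite ler_pdivrMr// mulrAC ler_pdivlMr//; lra.
Qed.

(* The dual value at the multiplier given by [multiplier_exists] is at least [m],
   hence so is the dual value at any optimal one. *)
Lemma optimal_multipliers_le (R : realType) (V : lmodType R) (A : set V)
    (phi g1 g2 : V -> R) (b m : R) :
  convex_set A -> convex_function A phi ->
  convex_function A g1 -> convex_function A g2 ->
  (forall u, A u -> m <= phi u + Num.max (g1 u) (g2 u)) ->
  optimal_multipliers [set z : V * R | A z.1]
    (fun z => phi z.1 + z.2) (fun z => g1 z.1 - z.2) (fun z => g2 z.1 - z.2)
    b (1 - b) ->
  forall u, A u -> m <= phi u + (b * g1 u + (1 - b) * g2 u).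
Proof.
move=> cA cphi cg1 cg2 mle [b0 b1 bopt] u Au.
have cphim : convex_function A (fun v => phi v + - m).
  exact: convex_functionD cphi (convex_function_cst (- m)).
(* The alternative is applied to [phi - m + g1] and [phi - m + g2]. *)
have [|c [/andP[c0 c1] cmin]] := multiplier_exists cA
    (convex_functionD cphim cg1) (convex_functionD cphim cg2).
  by move=> v Av; have := mle v Av; rewrite le_max maxEle; case: ifP => _ ?;
    apply/orP; [right|left]; lra.
rewrite -lee_fin; apply: le_trans (le_trans (bopt c (1 - c) _ _) _) => //.
(* The variable [r] cancels from the Lagrangian because the multipliers sum to 1. *)
- apply: le_ereal_inf_tmp => _ [[v r] /= Av <-]; rewrite lee_fin.
  by have := cmin v Av; lra.
- by lra.
- apply: ereal_inf_lbound; exists (u, 0) => //=; congr (_%:E); ring.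
Qed.

(** * Iterates and models of a run *)

Section TwoCutDDP.
(* Keeps the stage index explicit in the section variables. *)
Unset Implicit Arguments.
Context {R : realType} {T : nat} {n : nat -> nat} {x0 : 'rV[R]_(n 0%N)}
  {X : forall t : nat, set 'rV[R]_(n t)}
  {F : forall t : nat, 'rV[R]_(n t) -> 'rV[R]_(n t.-1) -> R}
  {x s : nat -> forall t : nat, 'rV[R]_(n t)} {beta : nat -> nat -> R}
  {Gam Gbar ell : nat -> forall t : nat, 'rV[R]_(n t) -> R}
  (hA : standing_assumptions T x0 X F)
  (hrun : two_cut_ddp T x0 X F x s beta Gam Gbar ell).
Set Implicit Arguments.

Lemma iterate_in k t : (1 <= k)%N -> (t <= T)%N -> X t (x k t).
Proof.
move=> k1; case: t => [_|t tT].
  by rewrite (A0_initial hA) (step2_initial hrun).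
have : [set x k t.+1] (x k t.+1) by [].
by rewrite -(step2_argmin hrun k1)//= => -[].
Qed.

Lemma iterate_min k t u : (1 <= k)%N -> (1 <= t <= T)%N -> X t u ->
  F t (x k t) (x k t.-1) + Gam k t (x k t) <= F t u (x k t.-1) + Gam k t u.
Proof.
move=> k1 tT; have : [set x k t] (x k t) by [].
by rewrite -(step2_argmin hrun k1 tT) => -[_]; exact.
Qed.

Lemma ell_affine k t : (1 <= k)%N -> (1 <= t < T)%N -> is_affine (ell k.+1 t).
Proof.
by move=> k1 tT; apply: affine_ext (step3_ell hrun k1 tT) (affine_cut _ _ _).
Qed.

Lemma Gam1_affine t : (1 <= t < T)%N -> is_affine (Gam 1%N t).
Proof.
by move=> tT; apply: affine_ext (step1_Gam hrun tT) (affine_cut _ _ _).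
Qed.

Lemma Gbar_affine k t : (1 <= k)%N -> (1 <= t < T)%N -> is_affine (Gbar k t).
Proof.
case: k => // k _ tT; elim: k => [|k IHk].
  by apply: affine_ext (step3_Gbar1 hrun tT) _; exact: Gam1_affine.
apply: affine_ext (step3_Gbar hrun (k := k.+2) isT tT) _.
by apply: affine_comb => //; exact: ell_affine.
Qed.

Lemma Gam_convex k t : (1 <= k)%N -> (1 <= t <= T)%N ->
  convex_function setT (Gam k t).
Proof.
move=> k1 /andP[t1]; rewrite leq_eqVlt => /predU1P[->|tT].
  by rewrite (funext (Gam_last hrun k1)); exact: convex_function_cst.
have tT' : (1 <= t < T)%N by rewrite t1.
case: k k1 => // -[_|k _]; first exact/affine_convex/Gam1_affine.
rewrite (funext (step3_Gam hrun (k := k.+1) isT tT')).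
by apply: convex_function_max; apply: affine_convex;
  [exact: ell_affine | exact: Gbar_affine].
Qed.

Lemma stage_cost_convex t y A : (1 <= t <= T)%N ->
  convex_function A (fun u => F t u y).
Proof.
move=> tT; apply/convex_functionP => a u v a01 _ _.
have /convex_functionP /(_ a (u, y) (v, y) a01 I I) /= := A1_convex hA tT.
by rewrite -scalerDl subrKC scale1r.
Qed.

(* [inf] is a junk value on sets unbounded below, so boundedness is needed.
   Joint convexity transfers it to all [y] from [x k t], where the minimum is
   attained by Step 2, through the midpoint of [y] and [2 x k t - y]. *)
Lemma stage_value_le k t u y : (1 <= k)%N -> (t < T)%N -> X t.+1 u ->
  stage_value X F (Gam k t.+1) y <= F t.+1 u y + Gam k t.+1 u.
Proof.
move=> k1 tT Xu; apply: ge_inf; last by exists u.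
have tT' : (1 <= t.+1 <= T)%N by [].
pose w := x k t.+1; have Xw : X t.+1 w by exact: iterate_in.
pose z : 'rV[R]_(n t) := x k t.
(* Obtained by doubling the convexity inequality at the midpoint of [(v, y)] and [(w, 2 *: z - y)],
   where the objective is at least its minimum, attained at [w]. *)
exists (2 * (F t.+1 w z + Gam k t.+1 w) - F t.+1 w (2 *: z - y) - Gam k t.+1 w).
move=> _ [v Xv <-].
have h01 : 0 <= (2^-1 : R) <= 1 by lra.
have /convex_setP /(_ _ _ _ h01 Xv Xw) := A0_convex hA tT'.
move=> /(iterate_min k1 tT') /=; rewrite -/w -/z => wmin.
have /convex_functionP /(_ _ v w h01 I I) := Gam_convex k1 tT'.
have /convex_functionP /(_ _ (v, y) (w, 2 *: z - y) h01 I I) /= := A1_convex hA tT'.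
have -> : 2^-1 *: y + (1 - 2^-1) *: (2 *: z - y) = z.
  by apply/rowP => i; rewrite !mxE; field.
by lra.
Qed.

(** * Minorization of the cost-to-go *)

(* Bounding every trajectory rather than [cost_to_go] avoids proving that the
   infima defining the latter are bounded below. *)
Definition minorizes t (f : 'rV[R]_(n t) -> R) : Prop :=
  forall u : forall s, 'rV[R]_(n s),
    (forall s, (t < s <= T)%N -> X s (u s)) -> f (u t) <= G_cost T F t u.

Lemma minorizes_cost_to_go t (f : 'rV[R]_(n t) -> R) v :
  minorizes f -> f v <= @cost_to_go R T n X F t v.
Proof.
move=> fG; apply: lb_le_inf => [|_ [u [<- Xu] <-]]; last exact: fG.
(* The infimum is over a nonempty set: the first iterates with component [t] replaced by [v] are
   admissible. *)
pose u := eqtype.dfwith (x 1%N) v.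
exists (G_cost T F t u), u => //; split=> [|r /andP[tr rT]].
  exact: dfwith_in.
by rewrite /u dfwith_out; [exact: iterate_in | rewrite neq_ltn tr].
Qed.

(** The cut lies below the stage value, which is tested with the trajectory's own [u t.+1];
    splitting off the first term of [G_cost] leaves the bound at stage [t.+1]. *)
Lemma cut_minorizes k t (z g : 'rV[R]_(n t)) :
  (1 <= k)%N -> (t < T)%N -> minorizes (Gam k t.+1) ->
  subgradient (stage_value X F (Gam k t.+1)) z g ->
  minorizes (fun v => stage_value X F (Gam k t.+1) z + dot g (v - z)).
Proof.
move=> k1 tT GamG sub u Xu; apply: le_trans (sub (u t)) _.
apply: le_trans (stage_value_le (u t) k1 tT (Xu t.+1 _)) _.
  by rewrite ltnSn.
rewrite /G_cost (big_ltn (m := t.+1))// lerD2l; apply: GamG => r /andP[tr rT].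
by apply: Xu; rewrite (ltn_trans _ tr).
Qed.

Lemma Gam_minorizes_rec k : (1 <= k)%N ->
  (forall t, (1 <= t < T)%N -> minorizes (Gam k t.+1) -> minorizes (Gam k t)) ->
  forall t, (1 <= t <= T)%N -> minorizes (Gam k t).
Proof.
(* Writing [t] as [T - (T - t)] turns backward recursion into induction on the distance to [T]. *)
move=> k1 Grec t /andP[t1 tT]; move: t1; rewrite -(subKn tT).
elim: (T - t)%N => [|m IHm] t1.
  by rewrite subn0 => u _; rewrite (Gam_last hrun k1) /G_cost big_geq.
have tS : (T - m.+1).+1 = (T - m)%N by lia.
by apply: Grec; [lia | rewrite tS; apply: IHm; lia].
Qed.

Lemma Gam1_minorizes t : (1 <= t <= T)%N -> minorizes (Gam 1%N t).
Proof.
apply: Gam_minorizes_rec => // r rT GamG u Xu; rewrite (step1_Gam hrun rT).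
apply: cut_minorizes => //; last exact: (step1_subgradient hrun rT).
by case/andP: rT.
Qed.

Lemma ell_minorizes k t : (1 <= k)%N -> (1 <= t < T)%N ->
  minorizes (Gam k.+1 t.+1) -> minorizes (ell k.+1 t).
Proof.
move=> k1 tT GamG u Xu; rewrite (step3_ell hrun k1 tT).
apply: cut_minorizes => //; last exact: (step3_subgradient hrun k1 tT).
by case/andP: tT.
Qed.

Lemma GamS_minorizes k : (1 <= k)%N ->
  (forall t, (1 <= t < T)%N -> minorizes (Gbar k t)) ->
  forall t, (1 <= t <= T)%N -> minorizes (Gam k.+1 t).
Proof.
move=> k1 GbarG; apply: Gam_minorizes_rec => // t tT GamG u Xu.
rewrite (step3_Gam hrun k1 tT) ge_max GbarG// andbT.
exact: ell_minorizes.
Qed.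

Lemma beta_itv k t : (2 <= k)%N -> (1 <= t < T)%N -> 0 <= beta k t <= 1.
Proof.
by move=> k2 tT; have [-> b1 _] := multiplier hrun k2 tT; rewrite -subr_ge0.
Qed.

(** Induction on [k] for all stages at once: [ell k.+1 t] rests on [Gam k.+1 t.+1], which involves
    [Gbar k] at later stages. *)
Lemma Gbar_minorizes k t : (1 <= k)%N -> (1 <= t < T)%N -> minorizes (Gbar k t).
Proof.
case: k => // k _; elim: k t => [|k IHk] t tT u Xu.
  rewrite (step3_Gbar1 hrun tT); apply: Gam1_minorizes => //.
  by case/andP: tT => -> /ltnW.
rewrite (step3_Gbar hrun (k := k.+2) isT tT).
have ellG : ell k.+2 t (u t) <= G_cost T F t u.
  apply: ell_minorizes => //; apply: GamS_minorizes => //.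
  by case/andP: tT.
have GbarG := IHk t tT u Xu.
have /andP[b0 b1] := beta_itv (k := k.+2) isT tT.
have -> : G_cost T F t u =
    beta k.+2 t * G_cost T F t u + (1 - beta k.+2 t) * G_cost T F t u by ring.
by rewrite lerD// ler_wpM2l// subr_ge0.
Qed.

(** * Comparison of [Gbar] with [Gam] at the iterate *)

Lemma Gbar_le_Gam k t u : (1 <= k)%N -> (1 <= t < T)%N ->
  Gbar k t u <= Gam k t u.
Proof.
case: k => // -[_ tT|k _ tT]; first by rewrite (step3_Gbar1 hrun tT).
rewrite (step3_Gbar hrun (k := k.+2) isT tT) (step3_Gam hrun (k := k.+1) isT tT).
have /andP[b0 b1] := beta_itv (k := k.+2) isT tT; rewrite /=.
set M := Num.max _ _.
have -> : M = beta k.+2 t * M + (1 - beta k.+2 t) * M by ring.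
by rewrite lerD// ler_wpM2l// ?subr_ge0// /M le_max lexx ?orbT.
Qed.

(** For [k = 1] the two models coincide; for [k >= 2] this is strong duality for the stage problem
    with multiplier [beta k t]. *)
Lemma optimal_value_le k t u : (1 <= k)%N -> (1 <= t < T)%N -> X t u ->
  F t (x k t) (x k t.-1) + Gam k t (x k t) <= F t u (x k t.-1) + Gbar k t u.
Proof.
move=> k1 tT; have tT' : (1 <= t <= T)%N by case/andP: tT => -> /ltnW.
case: k k1 => // -[_|k _] Xu.
  by rewrite (step3_Gbar1 hrun tT); exact: iterate_min.
rewrite (step3_Gbar hrun (k := k.+2) isT tT).
apply: (optimal_multipliers_le (A := X t) (phi := fun v => F t v (x k.+2 t.-1))
  (g1 := Gbar k.+1 t) (g2 := ell k.+2 t)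
  _ _ _ _ _ (multiplier hrun (k := k.+2) isT tT)).
- exact: (A0_convex hA tT').
- exact: stage_cost_convex.
- exact/affine_convex/Gbar_affine.
- exact/affine_convex/ell_affine.
- move=> v Xv; rewrite maxC -(step3_Gam hrun (k := k.+1) isT tT).
  exact: iterate_min.
- by [].
Qed.

Lemma Gbar_iterate k t : (1 <= k)%N -> (1 <= t < T)%N ->
  Gbar k t (x k t) = Gam k t (x k t).
Proof.
move=> k1 tT; apply/eqP; rewrite eq_le Gbar_le_Gam//=.
rewrite -(lerD2l (F t (x k t) (x k t.-1))); apply: optimal_value_le => //.
by apply: iterate_in => //; case/andP: tT => _ /ltnW.
Qed.

End TwoCutDDP.

Theorem proposition2p5 (R : realType) (T : nat) (n : nat -> nat)
    (x0 : 'rV[R]_(n 0%N)) (X : forall t : nat, set 'rV[R]_(n t))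
    (F : forall t : nat, 'rV[R]_(n t) -> 'rV[R]_(n t.-1) -> R)
    (x s : nat -> forall t : nat, 'rV[R]_(n t)) (beta : nat -> nat -> R)
    (Gam Gbar ell : nat -> forall t : nat, 'rV[R]_(n t) -> R)
    (hA : standing_assumptions T x0 X F)
    (hrun : two_cut_ddp T x0 X F x s beta Gam Gbar ell)
    (k t : nat) (hk : (1 <= k)%N) (ht : (1 <= t < T)%N) :
  is_affine (Gbar k t) /\
  is_shadow (X t) (@cost_to_go R T n X F t)
    (fun u => F t u (x k t.-1)) (Gam k t) (x k t) (Gbar k t).
Proof.
have [t1 /ltnW tT] := andP ht.
have tT' : (1 <= t <= T)%N by rewrite t1.
have Gaff := Gbar_affine hrun hk ht.
split=> //; split; last 1 first.
- have [mu [mu0 Fmu]] := A2_strongly_convex hA tT'.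
  apply: (strongly_convex_argmin_unique mu0 (Fmu _ _)).
  (* Strong convexity is assumed only for parameters in [X t.-1]; for [t = 1] the parameter is
     [x0]. *)
  + by apply: (iterate_in hA hrun hk); rewrite (leq_trans (leq_pred t)).
  + exact: (A0_convex hA tT').
  + exact: affine_convex.
  + split=> [|u Xu]; first exact: (iterate_in hA hrun hk).
    by rewrite (Gbar_iterate hA hrun hk ht); exact: (optimal_value_le hA hrun).
- split=> [||u _]; first exact: affine_convex.
  + exact/continuous_lsc_on/affine_continuous.
  + exact: (minorizes_cost_to_go hA hrun u (Gbar_minorizes hA hrun hk ht)).
- exact: (Gbar_iterate hA hrun hk ht).
Qed.
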